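(* Let $N,P,Q\in\mathbb{N}$ be positive, and let $E=\{y_0,\dots,y_{P-1}\}$ and $F=\{\lambda_0,\dots,\lambda_{Q-1}\}$ be finite subsets (of cardinality $P$ and $Q$) of the slice $\mathcal{S}_N=\{\rho e^{i\alpha}\mid\rho>0,\ \alpha\in[0,2\pi/N)\}\subset\mathbb{R}^2$. With the notation of the context, for every $f\in\mathrm{AP}_F(\mathbb{R}^2)$ the sampling of $f$ is connected with $\hat f$ by $$\big((\mathcal{F}\otimes\mathrm{id})\,\mathrm{sampl} f\big)_{\hat n,j}=\sum_{k=0}^{Q-1}J_{\hat n}(\lambda_k,y_j)\big((\mathcal{F}\otimes\mathrm{id})\hat f\big)_{\hat n,k},\qquad \hat n=0,\dots,N-1,\ j=0,\dots,P-1.$$ In particular, the AP interpolation problem on $(E,F)$ is well-posed if and only if all the matrices $\mathcal{J}^E_{\hat n}$, $\hat n=0,\dots,N-1$, are invertible.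
   Context: $\mathbb{R}^2$ is identified with $\mathbb{C}$ for polar coordinates; $R_\theta$ is the rotation of angle $\theta$ about the origin. $\mathrm{AP}_F(\mathbb{R}^2)$ is the space of functions $f:\mathbb{R}^2\to\mathbb{C}$ of the form $$f(x)=\sum_{n=0}^{N-1}\sum_{k=0}^{Q-1}\hat f(n,k)\,e^{i\langle R_{2\pi n/N}\lambda_k,\,x\rangle},\qquad \hat f\in\mathbb{C}^N\otimes\mathbb{C}^Q,$$ i.e. trigonometric sums with frequencies in $\tilde F=\bigcup_{n}R_{2\pi n/N}(F)$; $f$ determines $\hat f$ uniquely. The sampling of $\psi:\mathbb{R}^2\to\mathbb{C}$ on $\tilde E=\bigcup_nR_{2\pi n/N}(E)$ is $\mathrm{sampl}\,\psi\in\mathbb{C}^N\otimes\mathbb{C}^P$, $(\mathrm{sampl}\,\psi)(n,j)=\psi(R_{2\pi n/N}y_j)$. The operator $\mathcal{F}$ is the unitary discrete Fourier transform on $\mathbb{C}^N$: $\mathcal{F}v(\hat n)=\frac1{\sqrt N}\sum_{h=0}^{N-1}e^{-i\frac{2\pi}{N}\hat nh}v(h)$; $\mathcal{F}\otimes\mathrm{id}$ applies it in the first index. The generalized Bessel functions are, for $\hat n\in\{0,\dots,N-1\}$, $y=\rho e^{i\alpha}\in\mathcal{S}_N$ and $\lambda=\xi e^{i\omega}\in\mathcal{S}_N$, $$J_{\hat n}(\lambda,y)=\sum_{r=0}^{N-1}e^{i\left(\xi\rho\cos\left(\alpha-\omega+\frac{2\pi}{N}r\right)-\frac{2\pi}{N}\hat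 nr\right)}.$$ $\mathcal{J}_{\hat n}^E:\mathbb{C}^F\to\mathbb{C}^E$ is the linear map $(\mathcal{J}^E_{\hat n}\varphi)(y_j)=\sum_{k=0}^{Q-1}J_{\hat n}(\lambda_k,y_j)\varphi(\lambda_k)$, identified with its $P\times Q$ matrix. The AP interpolation problem on $(E,F)$ is well-posed if for every $\psi:\mathbb{R}^2\to\mathbb{C}$ there is exactly one $f\in\mathrm{AP}_F(\mathbb{R}^2)$ with $\mathrm{sampl}\,f=\mathrm{sampl}\,\psi$. *)

(* Defs.v *)
(* MathComp / MathComp-Analysis. The plane R^2 is [R * R]; complex values are
   in [R[i]]. *)
From HB Require Import structures.
From mathcomp Require Import all_boot all_order all_algebra.
From mathcomp Require Import complex.
From mathcomp Require Import boolp classical_sets reals topology trigo.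
From mathcomp Require Import lra.

Set Implicit Arguments.
Unset Strict Implicit.
Unset Printing Implicit Defensive.

Import Order.TTheory GRing.Theory Num.Theory.
Local Open Scope classical_set_scope.
Local Open Scope ring_scope.

Section Defs.
Variable R : realType.
Implicit Types (x y lam : R * R) (t rho alpha : R).

Definition expi t : R[i] := (cos t +i* sin t)%C.

Definition dotp x y : R := x.1 * y.1 + x.2 * y.2.

Definition rot t x : R * R :=
  (cos t * x.1 - sin t * x.2, sin t * x.1 + cos t * x.2).

(* The point rho e^{i alpha} under the identification of R^2 with C. *)
Definition polar rho alpha : R * R := (rho * cos alpha, rho * sin alpha).

(* The pair (rho, alpha) with x = rho e^{i alpha}, rho > 0 and alpha in
   [0, 2 pi), for x nonzero (see [polar_coordsK]); a junk value at the
   origin. *)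
Definition polar_coords x : R * R :=
  xget (0, 0) [set p | [/\ 0 < p.1, 0 <= p.2 < 2 * pi & x = polar p.1 p.2]].

Lemma polar_inj (r s a b : R) : 0 < r -> 0 < s ->
  0 <= a < 2 * pi -> 0 <= b < 2 * pi -> polar r a = polar s b ->
  r = s /\ a = b.
Proof.
move=> r0 s0 ha hb [hc hs].
have rs : r = s.
  apply: (@pexpIrn _ 2); rewrite ?nnegrE ?ltW //.
  rewrite -[r ^+ 2]mulr1 -[s ^+ 2]mulr1 -{1}(cos2Dsin2 a) -(cos2Dsin2 b).
  by rewrite !mulrDr -!exprMn hc hs.
split=> //; move: hc hs; rewrite rs => /(mulfI (lt0r_neq0 s0)) hc.
move=> /(mulfI (lt0r_neq0 s0)) hs.
wlog ab : a b ha hb hc hs / b <= a.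
  by move=> H; case: (leP b a) => [|/ltW] h; [|symmetry]; exact: H.
apply/eqP; rewrite eq_le ab andbT leNgt; apply/negP => ltba.
have : 0 < sin ((a - b) / 2).
  by apply: sin_gt0_pi; apply/andP; split; move: ha hb => /andP[? ?] /andP[? ?]; lra.
have : cos (a - b) = 1 by rewrite cosB hc hs -!expr2 cos2Dsin2.
have [d dE] : exists d, d = (a - b) / 2 by exists ((a - b) / 2).
rewrite -dE; have -> : a - b = d *+ 2 by rewrite -mulr_natr dE; lra.
rewrite cos_mulr2n cos2sin2 -mulr_natr => h h1.
by have := exprn_gt0 2 h1; lra.
Qed.

Lemma polar_coordsK rho alpha : 0 < rho -> 0 <= alpha < 2 * pi ->
  polar_coords (polar rho alpha) = (rho, alpha).
Proof.
move=> r0 ha; rewrite /polar_coords; apply: xget_subset1 => //=.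
move=> [r a] [s b] [/= r1 a1 ->] [/= r2 a2] /polar_inj.
by case=> // -> ->.
Qed.

Definition slice (N : nat) : set (R * R) :=
  [set x | exists rho alpha,
     [/\ 0 < rho, 0 <= alpha < 2 * pi / N%:R & x = polar rho alpha]].

Section Sampling.
Variables N P Q : nat.
Variables (y : 'I_P -> R * R) (lam : 'I_Q -> R * R).

(* Elements of C^N (x) C^Q are N x Q matrices. *)
Definition ap_sum (c : 'M[R[i]]_(N, Q)) (x : R * R) : R[i] :=
  \sum_(n < N) \sum_(k < Q)
    c n k * expi (dotp (rot (2 * pi * n%:R / N%:R) (lam k)) x).

Definition AP : set (R * R -> R[i]) := [set f | exists c, f = ap_sum c].

Definition sampl (psi : R * R -> R[i]) : 'M[R[i]]_(N, P) :=
  \matrix_(n, j) psi (rot (2 * pi * n%:R / N%:R) (y j)).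

Definition ap_well_posed : Prop :=
  forall psi : R * R -> R[i], exists! f, AP f /\ sampl f = sampl psi.

End Sampling.

Definition dft (N : nat) (v : 'cV[R[i]]_N) : 'cV[R[i]]_N :=
  \col_m (((Num.sqrt N%:R)^-1)%:C%C *
          \sum_(h < N) expi (- (2 * pi / N%:R * m%:R * h%:R)) * v h 0).

Definition dft_id (N K : nat) (A : 'M[R[i]]_(N, K)) : 'M[R[i]]_(N, K) :=
  \matrix_(n, k) dft (col k A) n 0.

Definition genBessel (N m : nat) (l x : R * R) : R[i] :=
  let: (xi, omega) := polar_coords l in
  let: (rho, alpha) := polar_coords x in
  \sum_(r < N) expi (xi * rho * cos (alpha - omega + 2 * pi / N%:R * r%:R)
                     - 2 * pi / N%:R * m%:R * r%:R).

Definition bessel_mx (N P Q : nat) (y : 'I_P -> R * R) (lam : 'I_Q -> R * R)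
    (m : nat) : 'M[R[i]]_(P, Q) :=
  \matrix_(j, k) genBessel N m (lam k) (y j).

(* [unitmx] only makes sense for matrices whose two dimensions are
   syntactically equal. *)
Definition mx_invertible (P Q : nat) (A : 'M[R[i]]_(P, Q)) : Prop :=
  exists B : 'M[R[i]]_(Q, P), A *m B = 1%:M /\ B *m A = 1%:M.

End Defs.

Arguments AP {R} N {Q} lam.
Arguments sampl {R} N {P} y psi.
Arguments ap_well_posed {R} N {P Q} y lam.

(* Main.v *)
Require Import Defs.
From HB Require Import structures.
From mathcomp Require Import all_boot all_order all_algebra.
From mathcomp Require Import complex.
From mathcomp Require Import boolp classical_sets reals topology trigo.
From mathcomp Require Import ring lra.

Set Implicit Arguments.
Unset Strict Implicit.
Unset Printing Implicit Defensive.

Import Order.TTheory GRing.Theory Num.Theory.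
Local Open Scope ring_scope.

(** In polar coordinates the phase of the frequency [R_{2 pi n/N} lambda]
    evaluated at [R_{2 pi h/N} y] depends only on [h - n], so sampling is a
    cyclic convolution in the first index and the discrete Fourier transform
    turns it into multiplication by the Bessel matrices.  Well-posedness means
    bijectivity of this map on coefficients: the rotated copies of a slice are
    disjoint, so samples can be prescribed freely, and Dedekind's independence
    of characters shows that [f] determines its coefficients. *)

(** * Plane waves: separation and linear independence *)

Section Expi.
Variable R : realType.
Implicit Types (s t rho alpha xi omega : R) (x z u v : R * R).

Lemma expiD s t : expi (s + t) = expi s * expi t.
Proof. by rewrite /expi cosD sinD [sin s * _ + _]addrC. Qed.

Lemma expi0 : expi 0 = 1 :> R[i].
Proof. by rewrite /expi cos0 sin0. Qed.

Lemma expi_pi : expi pi = -1 :> R[i].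
Proof.
by rewrite /expi cospi sinpi; apply/eqP; rewrite eq_complex /= oppr0 !eqxx.
Qed.

Lemma expi_neq0 t : expi t != 0.
Proof.
apply: contra_eq_neq (expi0) => t0.
by rewrite -(subrr t) expiD t0 mul0r eq_sym oner_neq0.
Qed.

Lemma expiX t n : expi (t * n%:R) = expi t ^+ n.
Proof.
elim: n => [|n IHn]; first by rewrite mulr0 expi0.
by rewrite -natr1 mulrDr mulr1 expiD IHn exprSr.
Qed.

Lemma expi_2pi_nat n : expi (2 * pi * n%:R) = 1 :> R[i].
Proof.
by rewrite expiX mulr_natl mulr2n expiD expi_pi mulrNN mulr1 expr1n.
Qed.

Lemma expi_inj s t : 0 <= s < 2 * pi -> 0 <= t < 2 * pi ->
  expi s = expi t -> s = t.
Proof.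
move=> hs ht [hc hn].
have [] // := @polar_inj R 1 1 s t ltr01 ltr01 hs ht.
by rewrite /polar !mul1r hc hn.
Qed.

(* [rot] alone would denote the rotation of sequences from [seq]. *)
Lemma rot_polar t rho alpha :
  Defs.rot t (polar rho alpha) = polar rho (alpha + t) :> R * R.
Proof. by rewrite /Defs.rot /polar /= cosD sinD; congr pair; ring. Qed.

Lemma dotp_polar xi omega rho alpha :
  dotp (polar xi omega) (polar rho alpha) =
    xi * rho * cos (alpha - omega) :> R.
Proof. by rewrite /dotp /polar /= cosB; ring. Qed.

Lemma dotpDr u x z : dotp u (x + z) = dotp u x + dotp u z.
Proof. by rewrite /dotp /=; ring. Qed.

Lemma expi_dotp_separates u v : u <> v ->
  exists x, expi (dotp u x) != expi (dotp v x).
Proof.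
move=> uv; pose q := (u.1 - v.1) ^+ 2 + (u.2 - v.2) ^+ 2.
have q0 : q != 0.
  apply/eqP => /eqP; rewrite paddr_eq0 ?sqr_ge0 // !sqrf_eq0 !subr_eq0.
  case/andP=> /eqP h1 /eqP h2; apply: uv.
  by rewrite [u]surjective_pairing h1 h2 -surjective_pairing.
(* Along this multiple of [u - v] the two phases differ by exactly [pi], so the two values are
   opposite and, being nonzero, distinct. *)
exists (pi / q * (u.1 - v.1), pi / q * (u.2 - v.2)).
set x := (_, _).
have -> : dotp u x = dotp v x + pi.
  by rewrite /dotp /x /=; rewrite /q in q0 *; field.
rewrite expiD expi_pi mulrN1 eq_sym -subr_eq0 opprK -mulr2n.
by rewrite mulrn_eq0 negb_or /= expi_neq0.
Qed.

(* Dedekind: subtracting [expi (dotp (g w) h)] times the relation at [x] from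
   the relation at [x + h] eliminates the frequency [g w]. *)
Lemma expi_dotp_free (T : eqType) (g : T -> R * R) (s : seq T) (a : T -> R[i]) :
  injective g -> uniq s ->
  (forall x, \sum_(i <- s) a i * expi (dotp (g i) x) = 0) ->
  {in s, forall i, a i = 0}.
Proof.
move=> ginj; elim: s a => [//|w s IHs] a /= /andP[ws us] sum0.
have a0 : {in s, forall i, a i = 0}.
  move=> t ts.
  have /expi_dotp_separates[h hE] : g t <> g w.
    by move/ginj => tw; rewrite -tw ts in ws.
  have := IHs (fun i => a i * (expi (dotp (g i) h) - expi (dotp (g w) h))) us.
  move=> /(_ _ t ts) /eqP; rewrite mulf_eq0 subr_eq0 (negPf hE) orbF.
  move=> H; apply/eqP/H => x.
  have := sum0 (x + h); rewrite big_cons dotpDr expiD.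
  have /eqP := sum0 x; rewrite big_cons addr_eq0 => /eqP.
  rewrite mulrA => ->; rewrite mulNr mulr_suml addrC => /eqP.
  rewrite subr_eq0 => /eqP E.
  under eq_bigr do rewrite mulrBr mulrBl.
  rewrite sumrB; apply/eqP; rewrite subr_eq0; apply/eqP.
  under [RHS]eq_bigr do rewrite mulrAC.
  rewrite -[RHS]E; apply: eq_bigr => i _.
  by rewrite dotpDr expiD mulrA mulrAC.
move=> t; rewrite inE => /predU1P[->|]; last exact: a0.
have /eqP := sum0 0; rewrite big_cons big_seq big1 ?addr0.
  by rewrite mulf_eq0 (negPf (expi_neq0 _)) orbF => /eqP.
by move=> i /a0 ->; rewrite mul0r.
Qed.

End Expi.

(** Each unit shift permutes the terms cyclically: by periodicity the new first term is the old last
    one. Shifting the argument of [G] avoids subtraction modulo [N] on the indices. *)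
Lemma sum_periodic_shift (R : pzRingType) (V : nmodType) (N : nat) (G : R -> V)
    (n : nat) :
  (forall t, G (t + N%:R) = G t) ->
  \sum_(h < N) G (h%:R - n%:R) = \sum_(h < N) G h%:R.
Proof.
case: N => [|N] perG; first by rewrite !big_ord0.
elim: n => [|n IHn]; first by apply: eq_bigr => h _; rewrite subr0.
rewrite -{}IHn big_ord_recl big_ord_recr /= addrC; congr (_ + _).
  apply: eq_bigr => h _; congr G.
  by rewrite /bump /= add1n -!natr1 opprD addrACA subrr addr0.
by rewrite -perG; congr G; rewrite -!natr1 sub0r opprD addrC addrACA subrr addr0.
Qed.

(** * Invertibility of the Fourier matrix *)

Section Dft.
Variables (R : realType) (N : nat).

Definition dft_mx : 'M[R[i]]_N :=
  \matrix_(m, h) (((Num.sqrt N%:R)^-1)%:C%C *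
                  expi (- (2 * pi / N%:R * m%:R * h%:R))).

Lemma dft_idE K (A : 'M[R[i]]_(N, K)) : dft_id A = dft_mx *m A.
Proof.
apply/matrixP => m k; rewrite !mxE mulr_sumr; apply: eq_bigr => h _.
by rewrite !mxE mulrA.
Qed.

(** For positive [N] this is a nonzero multiple of the Vandermonde matrix at the [N]-th roots of
    unity, which are pairwise distinct. *)
Lemma dft_mx_unit : dft_mx \in unitmx.
Proof.
case: (posnP N) => [N0|N0].
  by move: dft_mx; rewrite N0 => A; rewrite unitmxE det_mx00 unitr1.
have NR : 0 < N%:R :> R by rewrite ltr0n.
pose w : 'rV[R[i]]_N := \row_j expi (- (2 * pi / N%:R * j%:R)).
have -> : dft_mx = ((Num.sqrt N%:R)^-1)%:C%C *: Vandermonde N w.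
  apply/matrixP => m h; rewrite !mxE -expiX; congr (_ * expi _).
  by rewrite mulNr mulrAC.
rewrite unitmxE detZ unitrM unitrX ?andTb; last first.
  by rewrite unitfE (inj_eq (@complexI _)) invr_eq0 gt_eqF // sqrtr_gt0.
rewrite det_Vandermonde unitfE; apply/prodf_neq0 => i _.
apply/prodf_neq0 => j ij; rewrite !mxE subr_eq0; apply: contraTneq ij => E.
have dom (k : 'I_N) : 0 <= (2 * pi / N%:R * k%:R : R) < 2 * pi.
  have p0 := pi_gt0 R.
  rewrite mulr_ge0 ?divr_ge0 ?mulr_ge0 ?pi_ge0 //=.
  by rewrite mulrAC ltr_pdivrMr // ltr_pM2l ?ltr_nat // mulr_gt0.
(* The nodes carry negative angles, whereas [expi_inj] wants angles in [0, 2 pi); passing to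
   inverses reverses the sign. *)
have /expi_inj : expi (2 * pi / N%:R * i%:R) = expi (2 * pi / N%:R * j%:R : R).
  apply: (mulIf (expi_neq0 (- (2 * pi / N%:R * i%:R)))).
  by rewrite -{2}E -!expiD !subrr.
move=> /(_ (dom i) (dom j)) /mulfI H.
rewrite -leqNgt -(ler_nat R) H // gt_eqF // divr_gt0 // mulr_gt0 //.
exact: pi_gt0.
Qed.

End Dft.

(** * Rotated slices and Bessel sums *)

Section Sampling.
Variables (R : realType) (N P Q : nat).
Hypothesis N_gt0 : (0 < N)%N.

Let NR : 0 < N%:R :> R. Proof. by rewrite ltr0n. Qed.

Lemma slice_angle_lt2pi (alpha : R) :
  0 <= alpha < 2 * pi / N%:R -> 0 <= alpha < 2 * pi.
Proof.
move=> /andP[-> /lt_le_trans]; apply.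
by rewrite ler_pdivrMr // ler_peMr ?ler1n // mulr_ge0 // pi_ge0.
Qed.

(** The [n]-th copy of the slice is the sector of angles [2 pi n/N, 2 pi (n+1)/N). These sectors are
    disjoint, so the polar angle determines [n], and then the point. This serves both frequencies
    and sampling nodes. *)
Lemma rot_slice_inj K (z : 'I_K -> R * R) :
  injective z -> (forall k, slice N (z k)) ->
  injective (fun p : 'I_N * 'I_K => Defs.rot (2 * pi * p.1%:R / N%:R) (z p.2)).
Proof.
move=> zinj zs [n k] [n' k'] /=.
have [r [a [r0 ha zk]]] := zs k; have [r' [a' [r'0 ha' zk']]] := zs k'.
have p0 := pi_gt0 R.
have dom (b : R) (i : 'I_N) : 0 <= b < 2 * pi / N%:R ->
    0 <= b + 2 * pi * i%:R / N%:R < 2 * pi.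
  move=> /andP[b0 bN]; rewrite addr_ge0 ?divr_ge0 ?mulr_ge0 ?pi_ge0 //=.
  apply: (@lt_le_trans _ _ (2 * pi / N%:R + 2 * pi * i%:R / N%:R)).
    by rewrite ltrD2r.
  rewrite -mulrDl ler_pdivrMr // -{1}[2 * pi]mulr1 -mulrDr ler_pM2l ?mulr_gt0 //.
  by rewrite addrC natr1 ler_nat.
rewrite zk zk' !rot_polar => /polar_inj.
case/(_ r0 r'0 (dom _ _ ha) (dom _ _ ha')) => rr E.
(* Offsets smaller than one sector width force [i < i' + 1]; exchanging the roles then gives
   equality. *)
have lt_succ (i i' : 'I_N) (b b' : R) : 0 <= b < 2 * pi / N%:R ->
    0 <= b' < 2 * pi / N%:R ->
    b + 2 * pi * i%:R / N%:R = b' + 2 * pi * i'%:R / N%:R -> (i <= i')%N.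
  move=> /andP[b0 bN] /andP[b'0 b'N] e.
  rewrite -ltnS -(ltr_nat R) -natr1.
  rewrite -(@ltr_pM2l _ (2 * pi / N%:R)) ?divr_gt0 ?mulr_gt0 //.
  by rewrite [ltRHS]mulrDr mulr1 !(mulrAC _ N%:R^-1); lra.
have nn : n = n'.
  apply/val_inj/eqP; rewrite eqn_leq (lt_succ _ _ _ _ ha ha' E) /=.
  exact: (lt_succ _ _ _ _ ha' ha (esym E)).
rewrite nn in E *; congr pair; apply: zinj.
by rewrite zk zk' rr (addIr _ E).
Qed.

Lemma bessel_polar m xi omega rho alpha : 0 < xi -> 0 < rho ->
  0 <= omega < 2 * pi / N%:R -> 0 <= alpha < 2 * pi / N%:R ->
  genBessel N m (polar xi omega) (polar rho alpha) =
    \sum_(r < N) expi (xi * rho * cos (alpha - omega + 2 * pi / N%:R * r%:R)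
                       - 2 * pi / N%:R * m%:R * r%:R) :> R[i].
Proof.
move=> x0 r0 /slice_angle_lt2pi ho /slice_angle_lt2pi ha.
by rewrite /genBessel !polar_coordsK.
Qed.

(** The shift rule of the Fourier transform: the substitution [r = h - n] produces the Bessel sum
    and leaves a character in [n]. *)
Lemma sum_expi_rot_bessel (m n : nat) (l x : R * R) :
  slice N l -> slice N x ->
  \sum_(h < N) expi (- (2 * pi / N%:R * m%:R * h%:R)) *
     expi (dotp (Defs.rot (2 * pi * n%:R / N%:R) l)
                (Defs.rot (2 * pi * h%:R / N%:R) x)) =
  genBessel N m l x * expi (- (2 * pi / N%:R * m%:R * n%:R)).
Proof.
move=> [xi [omega [x0 ho ->]]] [rho [alpha [r0 ha ->]]].
rewrite bessel_polar //.
(* The Bessel summand at a real index: raising [t] by [N] changes the angle in the cosine by 2 pi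
   and the outer phase by a multiple of 2 pi. *)
pose G (t : R) : R[i] :=
  expi (xi * rho * cos (alpha - omega + 2 * pi / N%:R * t)
        - 2 * pi / N%:R * m%:R * t).
have N0 := gt_eqF NR.
have perG t : G (t + N%:R) = G t.
  rewrite /G !(mulrDr _ t) mulfVK ?N0 // addrA [2 * pi]mulr_natl cosD2pi.
  rewrite -[pi *+ 2]mulr_natl.
  have -> : 2 * pi / N%:R * m%:R * N%:R = 2 * pi * m%:R :> R.
    by rewrite mulrAC mulfVK ?N0.
  by rewrite -[LHS]mulr1 -(expi_2pi_nat R m) -expiD opprD addrA subrK.
rewrite -(sum_periodic_shift n perG) mulr_suml; apply: eq_bigr => h _.
rewrite !rot_polar dotp_polar /G -!expiD; congr expi.
have -> : alpha + 2 * pi * h%:R / N%:R - (omega + 2 * pi * n%:R / N%:R) =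
  alpha - omega + 2 * pi / N%:R * (h%:R - n%:R) by ring.
by ring.
Qed.

(** * Interpolation reduced to the Bessel matrices *)

Section Interpolation.
Variables (y : 'I_P -> R * R) (lam : 'I_Q -> R * R).
Hypotheses (y_slice : forall j, slice N (y j)).
Hypotheses (lam_slice : forall k, slice N (lam k)).

Lemma dft_sampl_ap_sum (c : 'M[R[i]]_(N, Q)) (m : 'I_N) (j : 'I_P) :
  dft_id (sampl N y (ap_sum lam c)) m j =
    \sum_(k < Q) genBessel N m (lam k) (y j) * dft_id c m k.
Proof.
rewrite !dft_idE mxE.
under eq_bigr do rewrite !mxE /ap_sum pair_big /= mulr_sumr.
(* [F n k] is the contribution of the frequency [(n, k)] once the sum over [h] is carried out. *)
pose F (n : 'I_N) (k : 'I_Q) := ((Num.sqrt N%:R)^-1)%:C%C * c n k *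
  (genBessel N m (lam k) (y j) * expi (- (2 * pi / N%:R * m%:R * n%:R))).
rewrite exchange_big /= (eq_bigr (fun p => F p.1 p.2)) => [|[n k] _ /=].
  rewrite -(pair_big xpredT xpredT F) exchange_big; apply: eq_bigr => k _.
  by rewrite mxE mulr_sumr; apply: eq_bigr => n _; rewrite !mxE /F; ring.
rewrite /F -sum_expi_rot_bessel // mulr_sumr; apply: eq_bigr => h _.
by rewrite mulrACA.
Qed.

(** After the transform the problem is block diagonal: row [m] of the data involves only row [m] of
    the coefficients. *)
Lemma dft_sampl_row (c : 'M[R[i]]_(N, Q)) (m : 'I_N) :
  (row m (dft_id (sampl N y (ap_sum lam c))))^T =
    bessel_mx N y lam m *m (row m (dft_id c))^T.
Proof.
apply/colP => j; rewrite mxE mxE dft_sampl_ap_sum mxE.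
by apply: eq_bigr => k _; rewrite !mxE.
Qed.

Hypotheses (y_inj : injective y) (lam_inj : injective lam).

Lemma ap_sum_inj : injective (@ap_sum R N Q lam).
Proof.
move=> c d E; apply/matrixP => n k.
have ginj := rot_slice_inj lam_inj lam_slice.
apply/eqP; rewrite -subr_eq0; apply/eqP.
apply: (@expi_dotp_free R _ _ (index_enum ('I_N * 'I_Q)%type)
  (fun p => c p.1 p.2 - d p.1 p.2) ginj (index_enum_uniq _) _ (n, k));
  last exact: mem_index_enum.
move=> x /=; under eq_bigr do rewrite mulrBl.
rewrite sumrB; apply/eqP; rewrite subr_eq0; apply/eqP.
by have := congr1 (@^~ x) E; rewrite /ap_sum !pair_big.
Qed.

Lemma sampl_surj (A : 'M[R[i]]_(N, P)) : exists psi, sampl N y psi = A.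
Proof.
have ginj := rot_slice_inj y_inj y_slice.
(* At most one index yields a given point; off the sampling nodes the value 0 is arbitrary. *)
exists (fun x => if [pick p : 'I_N * 'I_P |
  Defs.rot (2 * pi * p.1%:R / N%:R) (y p.2) == x] is Some p
  then A p.1 p.2 else 0).
apply/matrixP => n j; rewrite mxE; case: pickP => [p /eqP E|/(_ (n, j))].
  by have -> : p = (n, j) by apply: ginj.
by rewrite eqxx.
Qed.

Let dft_inj K : injective (@dft_id R N K).
Proof.
by move=> A B; rewrite !dft_idE; apply: (can_inj (mulKmx (dft_mx_unit R N))).
Qed.

Let dft_surj K (A : 'M[R[i]]_(N, K)) : exists B, dft_id B = A.
Proof.
by exists (invmx (dft_mx R N) *m A); rewrite dft_idE mulKVmx // dft_mx_unit.
Qed.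

Lemma well_posed_of_bessel :
  (forall m : 'I_N, mx_invertible (bessel_mx N y lam m)) ->
  ap_well_posed N y lam.
Proof.
move=> /choice[B BE] psi.
have [c cE] := dft_surj (\matrix_(m, k)
  (B m *m (row m (dft_id (sampl N y psi)))^T) k 0).
exists (ap_sum lam c); split=> [|_ [[d ->] dE]].
  split; first by exists c.
  apply: dft_inj; apply/row_matrixP => m; apply: trmx_inj.
  rewrite dft_sampl_row; have [BK _] := BE m.
  rewrite -[RHS]mul1mx -BK -mulmxA; congr (_ *m _).
  by apply/colP => k; rewrite mxE mxE cE mxE.
(* Uniqueness: the left inverses recover the transformed coefficients of any solution from its
   samples. *)
congr ap_sum; apply: dft_inj; rewrite cE; apply/matrixP => m k.
have [_ KB] := BE m.
by rewrite [LHS]mxE -dE dft_sampl_row mulmxA KB mul1mx !mxE.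
Qed.

(** Existence of interpolants makes each Bessel matrix surjective, uniqueness makes it injective;
    [P = Q] is not presupposed. *)
Lemma bessel_of_well_posed :
  ap_well_posed N y lam ->
  forall m : 'I_N, mx_invertible (bessel_mx N y lam m).
Proof.
move=> wp m; set J := bessel_mx N y lam m.
have Jsurj (w : 'cV[R[i]]_P) : exists v, J *m v = w.
  (* Data whose transform has [w] in every row, in particular in row [m]. *)
  have [A AE] := dft_surj (\matrix_(m' < N, j < P) w j 0).
  have [psi psiE] := sampl_surj A.
  have [_ [[[c ->] cE] _]] := wp psi.
  exists (row m (dft_id c))^T.
  rewrite -dft_sampl_row cE psiE AE; apply/colP => j.
  by rewrite !mxE.
have Jinj (v : 'cV[R[i]]_Q) : J *m v = 0 -> v = 0.
  move=> Jv0.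
  (* The kernel vector is placed in row [m] and zero elsewhere. The resulting function has zero
     samples, so uniqueness makes it the zero sum and [ap_sum_inj] gives [c = 0]. *)
  have [c cE] := dft_surj (\matrix_(m' < N, k < Q) (v k 0 *+ (m' == m))).
  have dft0 K : dft_id (0 : 'M[R[i]]_(N, K)) = 0 by rewrite dft_idE mulmx0.
  pose c0 : 'M[R[i]]_(N, Q) := 0.
  have ap0 : sampl N y (ap_sum lam c0) = 0.
    apply/matrixP => n j; rewrite !mxE /ap_sum big1 // => ? _.
    by rewrite big1 // => ? _; rewrite mxE mul0r.
  have [f [_ funi]] := wp (ap_sum lam c0).
  have cc0 : c = c0.
    apply: ap_sum_inj; rewrite -(funi (ap_sum lam c0)); last first.
      by split; first exists c0.
    symmetry; apply: funi; split; first by exists c.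
    rewrite ap0; apply: dft_inj; apply/row_matrixP => m'; apply: trmx_inj.
    rewrite dft_sampl_row dft0 row0 trmx0.
    have [->|mm] := eqVneq m' m.
      rewrite -[RHS]Jv0; congr (_ *m _).
      by apply/colP => k; rewrite mxE mxE cE mxE eqxx.
    rewrite (_ : (row m' _)^T = 0) ?mulmx0 //.
    by apply/colP => k; rewrite mxE mxE cE !mxE (negPf mm).
  apply/colP => k; have := congr1 (fun A : 'M_(N, Q) => A m k) cE.
  by rewrite cc0 dft0 !mxE eqxx.
have [B BE] := choice (fun j : 'I_P => Jsurj (delta_mx j 0)).
exists (\matrix_(k, j) B j k 0).
have JB : J *m (\matrix_(k, j) B j k 0) = 1%:M.
  apply/matrixP => i j; have := congr1 (fun w : 'cV_P => w i 0) (BE j).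
  by rewrite !mxE eqxx andbT => <-; apply: eq_bigr => k _; rewrite !mxE.
split=> //; set C := (X in X *m J).
apply/eqP; rewrite -subr_eq0; apply/eqP/matrixP => k k'.
(* Since [J *m C = 1%:M], multiplying [C *m J - 1%:M] by [J] on the left gives 0, and injectivity
   applies to each column. *)
have : col k' (C *m J - 1%:M) = 0.
  apply: Jinj; rewrite colE mulmxA mulmxBr mulmxA JB mul1mx mulmx1.
  by rewrite subrr mul0mx.
by move=> /(congr1 (fun w : 'cV_Q => w k 0)); rewrite !mxE.
Qed.

End Interpolation.
End Sampling.

Theorem corollary4 (R : realType) (N P Q : nat)
    (hN : (0 < N)%N) (hP : (0 < P)%N) (hQ : (0 < Q)%N)
    (y : 'I_P -> R * R) (lam : 'I_Q -> R * R)
    (y_inj : injective y) (lam_inj : injective lam)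
    (y_slice : forall j, slice N (y j))
    (lam_slice : forall k, slice N (lam k)) :
  (forall f : R * R -> R[i], AP N lam f ->
   forall fhat : 'M[R[i]]_(N, Q), f = ap_sum lam fhat ->
   forall (m : 'I_N) (j : 'I_P),
     dft_id (sampl N y f) m j =
       \sum_(k < Q) genBessel N m (lam k) (y j) * dft_id fhat m k) /\
  (ap_well_posed N y lam <->
   forall m : 'I_N, mx_invertible (bessel_mx N y lam m)).
Proof.
split=> [f _ fhat -> m j|]; first exact: dft_sampl_ap_sum.
split; first exact: bessel_of_well_posed.
exact: well_posed_of_bessel.
Qed.
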